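(* Let $t\in(-1,0)$ and let $a_1,a_2$ be real numbers such that $a_1>0>a_2$, $a_1^2+a_2^2=1$, and $a_1>|a_2|$. Let $\Phi_{a_1,a_2}:\mathrm{Sym}\to\mathbb R$ be the specialization $F\mapsto F(a_1,a_2)$. Then for each $\star\in\{\mathscr E,\mathscr O\}$, the restriction $\Phi$ of $\Phi_{a_1,a_2}$ to $\mathrm{Sym}^\star$ satisfies: ($p_2$-harmonicity) $\Phi(p_2F)=\Phi(F)$ for all $F\in\mathrm{Sym}^\star$; (positivity) $\Phi$ is nonnegative on the convex cone $C^{\mathrm{HL}}_\star(t)$.
   Context: $\mathrm{Sym}$ is the graded $\mathbb R$-algebra of symmetric functions, freely generated by the power sums $p_1,p_2,\dots$; $F(a_1,a_2)$ is the value of $F$ with two variables set to $a_1,a_2$ and all others to $0$. $\mathrm{Sym}^{\mathscr E}$ and $\mathrm{Sym}^{\mathscr O}$ are the subspaces spanned by homogeneous elements of even and odd degree. For a partition $\lambda$: $n(\lambda)=\sum_i(i-1)\lambda_i$, $m_i(\lambda)=\#\{j:\lambda_j=i\}$ for $i\ge1$. The Hall–Littlewood function $P_\lambda(\,;t)\in\mathrm{Sym}$ is given in $N\ge\ell(\lambda)$ variables by $$P_\lambda(x_1,\dots,x_N;t)=\frac1{v_\lambda(t)}\sum_{w\in S_N}w\Bigl(x_1^{\lambda_1}\cdots x_N^{\lambda_N}\prod_{i<j}\frac{x_i-tx_j}{x_i-x_j}\Bigr),\quad v_\lambda(t)=\prod_{i\ge0}\prod_{j=1}^{m_i}\frac{1-t^j}{1-t},$$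 with $m_0=N-\ell(\lambda)$, $m_i=m_i(\lambda)$ ($i\ge1$). Put $Q_\lambda(\,;t)=\prod_{i\ge1}\prod_{j=1}^{m_i(\lambda)}(1-t^j)\cdot P_\lambda(\,;t)$ and $\widetilde Q_\lambda(\,;t)=(-1)^{n(\lambda)}Q_\lambda(\,;t)$. $C^{\mathrm{HL}}_{\mathscr E}(t)\subset\mathrm{Sym}^{\mathscr E}$ (resp. $C^{\mathrm{HL}}_{\mathscr O}(t)\subset\mathrm{Sym}^{\mathscr O}$) is the convex cone spanned by all $\widetilde Q_\lambda(\,;t)$ with $|\lambda|$ even (resp. odd). *)

(* Defs.v *)
From HB Require Import structures.
From mathcomp Require Import all_boot all_order all_fingroup all_algebra.
From mathcomp Require Import finmap.
From mathcomp Require Import reals.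
(* monalg and mpoly share many names: unqualified, they are those of mpoly, but
   {mpoly R[n]} is that of monalg, so that we write [mpoly n R] instead. *)
From mathcomp.multinomials Require Import monalg mpoly.

Set Implicit Arguments.
Unset Strict Implicit.
Unset Printing Implicit Defensive.

Import GRing.Theory Num.Theory.
Local Open Scope ring_scope.

(** Spans and cones of subsets of a vector space, given as Prop predicates.   *)

Definition linear_span (R : nzRingType) (V : lmodType R) (S : V -> Prop)
    (v : V) : Prop :=
  exists (n : nat) (c : 'I_n -> R) (u : 'I_n -> V),
    (forall i, S (u i)) /\ v = \sum_i c i *: u i.

Definition convex_cone (R : numDomainType) (V : lmodType R) (S : V -> Prop)
    (v : V) : Prop :=
  exists (n : nat) (c : 'I_n -> R) (u : 'I_n -> V),
    (forall i, 0 <= c i /\ S (u i)) /\ v = \sum_i c i *: u i.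

(** Symmetric functions.  [symfun R] is the free commutative R-algebra on generators
    indexed by nat, the generator of index k being the power sum p_(k+1).     *)

Definition symfun (R : realType) := {malg R[{cmonom nat}]}.

(* [power_sum k] is p_k, for k >= 1 only. *)
Definition power_sum (R : realType) (k : nat) : symfun R :=
  << 1 *g ucm k.-1 >>.

(* The generator p_(k+1) has degree k+1. *)
Definition pdegree (m : {cmonom nat}) : nat :=
  (\sum_(k <- finsupp m) k.+1 * m k)%N.

Definition homogeneous (R : realType) (d : nat) (F : symfun R) : Prop :=
  forall m, m \in monalg.msupp F -> pdegree m = d.

(* The parity b is [false] for Sym^E and [true] for Sym^O. *)
Definition sym_part (R : realType) (b : bool) (F : symfun R) : Prop :=
  linear_span (fun G => exists2 d, odd d = b & homogeneous d G) F.

(* The value of F when N variables are set to x_0, ..., x_(N-1) in a commutative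
   R-algebra, with structure morphism f, and all others to 0: it is the algebra
   morphism with p_k |-> x_0^k + ... + x_(N-1)^k. *)
Definition sym_eval (R : realType) (A : comNzRingType) (f : R -> A)
    (N : nat) (x : 'I_N -> A) (F : symfun R) : A :=
  monalg.mmap f (fun m : {cmonom nat} =>
            \prod_(k <- finsupp m) (\sum_(i < N) x i ^+ k.+1) ^+ m k) F.

Definition sym_vars (R : realType) (N : nat) (F : symfun R) : mpoly N R :=
  sym_eval (@mpolyC N R) (fun i : 'I_N => 'X_i) F.

Definition Phi (R : realType) (a1 a2 : R) (F : symfun R) : R :=
  sym_eval idfun (fun i : 'I_2 => if i == ord0 then a1 else a2) F.

Definition is_partition (lam : seq nat) : bool :=
  sorted geq lam && (0%N \notin lam).

(* Parts are indexed from 0 here, whence i instead of i - 1. *)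
Definition part_n (lam : seq nat) : nat :=
  (\sum_(0 <= i < size lam) i * nth 0 lam i)%N.

(* m_i of lam seen as having N parts, zeros included. *)
Definition part_mult (N : nat) (lam : seq nat) (i : nat) : nat :=
  if i == 0%N then (N - size lam)%N else count_mem i lam.

(* m_i = 0 for i > |lam| = sumn lam, so the products over i are finite. *)
Definition v_coef (R : realType) (t : R) (N : nat) (lam : seq nat) : R :=
  \prod_(0 <= i < (sumn lam).+1)
    \prod_(1 <= j < (part_mult N lam i).+1) ((1 - t ^+ j) / (1 - t)).

Definition b_coef (R : realType) (t : R) (lam : seq nat) : R :=
  \prod_(1 <= i < (sumn lam).+1)
    \prod_(1 <= j < (count_mem i lam).+1) (1 - t ^+ j).

Definition ratfun (R : realType) (N : nat) := {fraction (mpoly N R)}.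

Definition rconst (R : realType) (N : nat) (c : R) : ratfun R N :=
  tofrac c%:MP_[N].

Definition rvar (R : realType) (N : nat) (i : 'I_N) : ratfun R N :=
  tofrac 'X_i.

Definition hall_littlewood_formula (R : realType) (t : R) (lam : seq nat)
    (N : nat) : ratfun R N :=
  (rconst N (v_coef t N lam))^-1 *
  \sum_(w : 'S_N)
     (\prod_(i < N) rvar R (w i) ^+ nth 0%N lam i) *
     (\prod_(i < N) \prod_(j < N | (i < j)%N)
        ((rvar R (w i) - rconst N t * rvar R (w j)) /
         (rvar R (w i) - rvar R (w j)))).

(* [is_P t lam F]: F is P_lam( ; t), i.e. F is given by the formula above in
   each number N >= l(lam) of variables.  These conditions determine F, as an
   element of [symfun R] is determined by its images in all large enough numbers
   of variables. *)
Definition is_P (R : realType) (t : R) (lam : seq nat) (F : symfun R) : Prop :=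
  forall N : nat, (size lam <= N)%N ->
    tofrac (sym_vars N F) = hall_littlewood_formula t lam N.

Definition is_Q (R : realType) (t : R) (lam : seq nat) (F : symfun R) : Prop :=
  exists2 P, is_P t lam P & F = b_coef t lam *: P.

Definition is_Qtilde (R : realType) (t : R) (lam : seq nat) (F : symfun R) : Prop :=
  exists2 Q, is_Q t lam Q & F = (-1) ^+ part_n lam *: Q.

Definition C_HL (R : realType) (b : bool) (t : R) (F : symfun R) : Prop :=
  convex_cone (fun G => exists lam : seq nat,
    [/\ is_partition lam, odd (sumn lam) = b & is_Qtilde t lam G]) F.

(* Main.v *)
Require Import Defs.
From HB Require Import structures.
From mathcomp Require Import all_boot all_order all_fingroup all_algebra.
From mathcomp Require Import finmap.
From mathcomp Require Import reals.
From mathcomp Require Import ring lra zify.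
From mathcomp.multinomials Require Import monalg mpoly.

Set Implicit Arguments.
Unset Strict Implicit.
Unset Printing Implicit Defensive.

Import Order.TTheory GRing.Theory Num.Theory.
Local Open Scope ring_scope.

(** The harmonicity holds because [Phi] is an algebra morphism and
    [p_2 |-> a1^2 + a2^2 = 1].  For positivity, only partitions with at most
    two parts matter, as P_lambda in two variables is 0 otherwise.  For
    lambda = (m + n, n), the formula gives, up to a positive factor,
      (a1 a2)^n (a1^m (a1 - t a2) - a2^m (a2 - t a1)) / (a1 - a2).
    Here (-1)^n(lambda) = (-1)^n makes the first factor positive, and the second
    one is nonnegative since |a2| < a1 and, from -1 < t < 0,
    |a2 - t a1| <= a1 - t a2. *)

(** * Values of fractions along a ring morphism *)

Section Specialization.

Variables (A : idomainType) (K : fieldType) (h : {rmorphism A -> K}).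

(* Extension of [h] to the fractions whose denominator is not in its kernel. *)
Definition specializes (x : {fraction A}) (y : K) : Prop :=
  exists p q, [/\ h q != 0, x = tofrac p / tofrac q & y = h p / h q].

Lemma tofrac_neq0 q : h q != 0 -> tofrac q != 0.
Proof. by rewrite tofrac_eq0; apply: contraNneq => ->; rewrite rmorph0. Qed.

Lemma specializes_tofrac p : specializes (tofrac p) (h p).
Proof. by exists p, 1; rewrite !rmorph1 oner_neq0 !divr1. Qed.

Lemma specializesD x1 x2 y1 y2 :
  specializes x1 y1 -> specializes x2 y2 -> specializes (x1 + x2) (y1 + y2).
Proof.
move=> [p1 [q1 [q1N0 -> ->]]] [p2 [q2 [q2N0 -> ->]]].
exists (p1 * q2 + p2 * q1), (q1 * q2); rewrite !rmorphD !rmorphM mulf_neq0 //.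
by split=> //; rewrite addf_div ?tofrac_neq0.
Qed.

Lemma specializesM x1 x2 y1 y2 :
  specializes x1 y1 -> specializes x2 y2 -> specializes (x1 * x2) (y1 * y2).
Proof.
move=> [p1 [q1 [q1N0 -> ->]]] [p2 [q2 [q2N0 -> ->]]].
exists (p1 * p2), (q1 * q2); rewrite !rmorphM mulf_neq0 //.
by split=> //; rewrite mulf_div.
Qed.

Lemma specializesV x y : y != 0 -> specializes x y -> specializes x^-1 y^-1.
Proof.
move=> yN0 [p [q [qN0 -> Dy]]]; exists q, p; rewrite !invf_div Dy invf_div.
by split=> //; apply: contraNneq yN0; rewrite Dy => ->; rewrite mul0r.
Qed.

Lemma specializes_sum (I : finType) (P : pred I) (F : I -> {fraction A}) G :
  (forall i, P i -> specializes (F i) (G i)) ->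
  specializes (\sum_(i | P i) F i) (\sum_(i | P i) G i).
Proof.
move=> FG; apply: (big_ind2 specializes) => //; last first.
  by move=> *; exact: specializesD.
by rewrite -(rmorph0 (@tofrac A)) -(rmorph0 h); exact: specializes_tofrac.
Qed.

Lemma specializes_prod (I : finType) (P : pred I) (F : I -> {fraction A}) G :
  (forall i, P i -> specializes (F i) (G i)) ->
  specializes (\prod_(i | P i) F i) (\prod_(i | P i) G i).
Proof.
move=> FG; apply: (big_ind2 specializes) => //; last first.
  by move=> *; exact: specializesM.
by rewrite -(rmorph1 (@tofrac A)) -(rmorph1 h); exact: specializes_tofrac.
Qed.

(** The value does not depend on the chosen representation: p = p' / q means p' = p q in [A], and it
    remains to apply [h] and divide by h q. Identities between fractions thus become identities in
    [K]. *)
Lemma specializes_tofrac_inj p y : specializes (tofrac p) y -> h p = y.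
Proof.
move=> [p' [q [qN0 /eqP E ->]]]; move: E.
rewrite eq_sym -subr_eq0 -(mulfK (tofrac_neq0 qN0) (tofrac p)) -mulrBl.
rewrite mulf_eq0 invr_eq0 (negbTE (tofrac_neq0 qN0)) orbF subr_eq0 -rmorphM.
by rewrite tofrac_eq => /eqP ->; rewrite rmorphM mulfK.
Qed.

End Specialization.

(** * Values of symmetric functions *)

Section SymEval.

(** The monomial map inside [sym_eval] gets a name so that it can carry a multiplicative structure,
    which makes [monalg.mmap] a ring morphism. *)
Definition power_product (A : comNzRingType) (q : nat -> A)
    (m : {cmonom nat}) :=
  \prod_(k <- finsupp m) q k ^+ m k.

Lemma power_productEw (A : comNzRingType) (q : nat -> A) (m : {cmonom nat})
    (d : {fset nat}) :
  (finsupp m `<=` d)%fset -> power_product q m = \prod_(k <- d) q k ^+ m k.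
Proof.
move=> le; rewrite /power_product (big_fset_incl _ le) // => k _.
by rewrite -cmE_eq0 => /eqP ->; rewrite expr0.
Qed.

Lemma power_product_mmorphism (A : comNzRingType) (q : nat -> A) :
  mmorphism (power_product q).
Proof.
split=> [m1 m2|]; last by rewrite /power_product mdom1 big_seq_fset0.
rewrite {1}/power_product mdomD (power_productEw _ (fsubsetUl _ (finsupp m2))).
rewrite (power_productEw _ (fsubsetUr (finsupp m1) _)) -big_split /=.
by apply: eq_bigr => k _; rewrite cmM exprD.
Qed.

HB.instance Definition _ (A : comNzRingType) (q : nat -> A) :=
  monalg.isMultiplicative.Build {cmonom nat} A (power_product q)
    (power_product_mmorphism q).

Lemma sym_evalE (R : realType) (A : comNzRingType) (f : R -> A) N
    (x : 'I_N -> A) F :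
  sym_eval f x F =
  monalg.mmap f (power_product (fun k => \sum_(i < N) x i ^+ k.+1)) F.
Proof. by []. Qed.

Lemma rmorph_sym_eval (R : realType) (A B : comNzRingType)
    (g : {rmorphism A -> B}) (f : R -> A) N (x : 'I_N -> A) F :
  g (sym_eval f x F) = sym_eval (g \o f) (g \o x) F.
Proof.
rewrite !sym_evalE !monalg.mmapE rmorph_sum; apply: eq_bigr => m _ /=.
rewrite rmorphM rmorph_prod; congr (_ * _); apply: eq_bigr => k _.
rewrite rmorphXn rmorph_sum; congr (_ ^+ _); apply: eq_bigr => i _.
by rewrite rmorphXn.
Qed.

Lemma eq_sym_eval (R : realType) (A : comNzRingType) (f g : R -> A) M N
    (x : 'I_M -> A) (y : 'I_N -> A) :
  f =1 g ->
  (forall k, \sum_(i < M) x i ^+ k.+1 = \sum_(i < N) y i ^+ k.+1) ->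
  sym_eval f x =1 sym_eval g y.
Proof.
move=> fg xy F; rewrite !sym_evalE !monalg.mmapE; apply: eq_bigr => m _.
by rewrite fg; congr (_ * _); apply: eq_bigr => k _; rewrite xy.
Qed.

Variables (R : realType) (a1 a2 : R).

Let x := fun i : 'I_2 => if i == ord0 then a1 else a2.

Lemma PhiE F : Phi a1 a2 F =
  monalg.mmap idfun (power_product (fun k => \sum_(i < 2) x i ^+ k.+1)) F.
Proof. by []. Qed.

Lemma Phi_power_sumM k F : (0 < k)%N ->
  Phi a1 a2 (power_sum R k * F) = (a1 ^+ k + a2 ^+ k) * Phi a1 a2 F.
Proof.
move=> k_gt0; rewrite !PhiE rmorphM; congr (_ * _).
rewrite /= /power_sum monalg.mmapU /power_product mdomU big_seq_fset1 cmUU.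
by rewrite prednK // expr1 mul1r !big_ord_recl big_ord0 addr0.
Qed.

Lemma PhiZ c F : Phi a1 a2 (c *: F) = c * Phi a1 a2 F.
Proof. by rewrite !PhiE monalg.mmapZ. Qed.

Lemma Phi_sum n (F : 'I_n -> symfun R) :
  Phi a1 a2 (\sum_i F i) = \sum_i Phi a1 a2 (F i).
Proof. by rewrite PhiE rmorph_sum. Qed.

End SymEval.

(** The formula may be evaluated term by term because no denominator vanishes: [w] is a permutation
    and [h] separates the variables, so each difference with i < j has a nonzero image. *)
Lemma hall_littlewood_specialization (R : realType) (t : R) lam P N
    (K : fieldType) (h : {rmorphism mpoly N R -> K}) :
  is_P t lam P -> (size lam <= N)%N ->
  injective (fun i : 'I_N => h 'X_i) ->
  h (v_coef t N lam)%:MP != 0 ->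
  h (sym_vars N P) = (h (v_coef t N lam)%:MP)^-1 *
    \sum_(w : 'S_N)
      (\prod_(i < N) h 'X_(w i) ^+ nth 0%N lam i) *
      (\prod_(i < N) \prod_(j < N | (i < j)%N)
        ((h 'X_(w i) - h t%:MP * h 'X_(w j)) / (h 'X_(w i) - h 'X_(w j)))).
Proof.
move=> hP leN inj vN0; apply: specializes_tofrac_inj; rewrite hP //.
apply: specializesM; first exact/specializesV/specializes_tofrac.
apply: specializes_sum => w _; apply: specializesM.
  apply: specializes_prod => i _.
  by rewrite -!rmorphXn; exact: specializes_tofrac.
apply: specializes_prod => i _; apply: specializes_prod => j ij.
apply: specializesM.
  by rewrite -rmorphM -rmorphB -rmorphM -rmorphB; exact: specializes_tofrac.
apply: specializesV; last by rewrite -!rmorphB; exact: specializes_tofrac.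
rewrite subr_eq0; apply: contraTneq ij => /inj /perm_inj ->.
by rewrite ltnn.
Qed.

(** * Signs of the constants, and sums and products for two variables *)

Lemma one_sub_exp_gt0 (R : realDomainType) (t : R) j :
  `|t| < 1 -> (0 < j)%N -> 0 < 1 - t ^+ j.
Proof.
move=> t1 j_gt0; rewrite subr_gt0 (le_lt_trans (ler_norm _)) // normrX.
by rewrite exprn_ilt1 // -lt0n.
Qed.

Lemma v_coef_gt0 (R : realType) (t : R) N lam : `|t| < 1 -> 0 < v_coef t N lam.
Proof.
move=> t1; apply: prodr_gt0 => i _; rewrite big_nat; apply: prodr_gt0 => j.
case/andP=> j_gt0 _; rewrite divr_gt0 ?one_sub_exp_gt0 //.
by rewrite -[t in 1 - t]expr1 one_sub_exp_gt0.
Qed.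

Lemma b_coef_gt0 (R : realType) (t : R) lam : `|t| < 1 -> 0 < b_coef t lam.
Proof.
move=> t1; apply: prodr_gt0 => i _; rewrite big_nat; apply: prodr_gt0 => j.
by case/andP=> j_gt0 _; rewrite one_sub_exp_gt0.
Qed.

Lemma big_perm2 (V : nmodType) (F : 'S_2 -> V) :
  \sum_w F w = F 1%g + F (tperm ord0 ord_max).
Proof.
have Dlast (i : 'I_2) : i != ord0 -> i = ord_max.
  by case: i => -[|[|//]] //= ? _; apply: val_inj.
rewrite (bigD1 1%g) //= (bigD1 (tperm ord0 ord_max)) /=; last first.
  by apply/eqP => /permP/(_ ord0); rewrite tpermL perm1.
rewrite big1 ?addr0 // => w /andP[].
have [w0|/Dlast w0] := eqVneq (w ord0) ord0.
  case/eqP; apply/permP => i; rewrite perm1.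
  have [->//|/[dup] i0 /Dlast ->] := eqVneq i ord0.
  by apply: Dlast; rewrite -w0 (inj_eq perm_inj).
move=> _ /eqP[]; apply/permP => i.
have [->|/[dup] i0 /Dlast ->] := eqVneq i ord0; rewrite ?tpermL ?tpermR //.
have [->//|/Dlast] := eqVneq (w ord_max) ord0.
by rewrite -[X in _ = X -> _]w0 => /perm_inj.
Qed.

Lemma prod_ltn_ord2 (A : comNzRingType) (G : 'I_2 -> 'I_2 -> A) :
  \prod_(i < 2) \prod_(j < 2 | (i < j)%N) G i j = G ord0 ord_max.
Proof.
have L : lift ord0 ord0 = ord_max :> 'I_2 by apply: val_inj.
rewrite !big_ord_recl big_ord0 L !(big_mkcond (fun j : 'I_2 => (_ < j)%N)).
by rewrite !big_ord_recl !big_ord0 L /= !(mul1r, mulr1).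
Qed.

(** * The Hall-Littlewood functions at (a1, a2) *)

Section TwoVariables.

Variables (R : realType) (t a1 a2 : R).
Hypotheses (tN1 : -1 < t) (t0 : t < 0) (a2_lt0 : a2 < 0) (a1_gt0 : 0 < a1).
Hypothesis a2_lt_a1 : - a2 < a1.

Let t1 : `|t| < 1.
Proof. by rewrite ltr_norml tN1 (lt_trans t0). Qed.

(** As a1 and a2 are distinct, the formula for N = 2 can be evaluated directly; the two terms come
    from the identity and the transposition. *)
Lemma Phi_is_P_two_parts lam P : is_P t lam P -> (size lam <= 2)%N ->
  Phi a1 a2 P = (v_coef t 2 lam)^-1 *
    (a1 ^+ nth 0%N lam 0 * a2 ^+ nth 0%N lam 1 * ((a1 - t * a2) / (a1 - a2)) +
     a2 ^+ nth 0%N lam 0 * a1 ^+ nth 0%N lam 1 * ((a2 - t * a1) / (a2 - a1))).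
Proof.
move=> hP size2; pose x := fun i : 'I_2 => if i == ord0 then a1 else a2.
have xE i : meval x 'X_i = x i by rewrite mevalXU.
have -> : Phi a1 a2 P = meval x (sym_vars 2 P).
  rewrite /sym_vars rmorph_sym_eval; apply: eq_sym_eval => [c|k] /=.
    by rewrite mevalC.
  by apply: eq_bigr => i _; rewrite xE.
rewrite (hall_littlewood_specialization hP) //; first last.
- by rewrite /= mevalC gt_eqF ?v_coef_gt0.
- move=> i j; rewrite /= !xE /x.
  have a12 := lt_eqF (lt_trans a2_lt0 a1_gt0).
  by case: i j => [[|[|//]] ?] [[|[|//]] ?] /= /eqP;
    rewrite ?[a1 == a2]eq_sym ?a12 // => _; exact: val_inj.
rewrite /= !mevalC; congr (_ * _).
rewrite big_perm2 !prod_ltn_ord2 !big_ord_recl !big_ord0 !mulr1.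
rewrite [lift _ _](_ : _ = ord_max); last exact: val_inj.
by rewrite !perm1 tpermL tpermR !mevalXU.
Qed.

Lemma weighted_power_le m :
  a2 ^+ m * (a2 - t * a1) <= a1 ^+ m * (a1 - t * a2).
Proof.
have a2a1 : `|a2| <= a1 by rewrite ltr0_norm // ltW.
apply: le_trans (ler_norm _) _; rewrite normrM normrX.
apply: ler_pM; rewrite ?exprn_ge0 //.
  by rewrite lerXn2r ?nnegrE // ltW.
rewrite ler_norml; move: tN1 t0 a2_lt0 a1_gt0 a2_lt_a1 => *.
(* The two bounds amount to (1 - t)(a1 + a2) >= 0 and (1 + t)(a1 - a2) >= 0. *)
by apply/andP; split; nra.
Qed.

Lemma part_n_two_parts lam : (size lam <= 2)%N -> part_n lam = nth 0%N lam 1.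
Proof.
by case: lam => [|l1 [|l2 [|//]]] _;
  rewrite /part_n unlock //= mul0n !add0n ?mul1n ?addn0.
Qed.

Lemma Phi_is_P_two_parts_ge0 lam P :
  is_partition lam -> is_P t lam P -> (size lam <= 2)%N ->
  0 <= (-1) ^+ part_n lam * Phi a1 a2 P.
Proof.
move=> /andP[lam_sorted _] hP size2; rewrite part_n_two_parts //.
rewrite (Phi_is_P_two_parts hP) // mulrCA.
rewrite mulr_ge0 ?invr_ge0 ?(ltW (v_coef_gt0 _ _ _)) //.
(* Write lambda = (m + n, n); the default value 0 of [nth] covers partitions with fewer than two
   parts. *)
have /subnK <- : (nth 0 lam 1 <= nth 0 lam 0)%N.
  by case: lam lam_sorted size2 {hP} => [|l1 [|l2 l]] //= /andP[].
move: (nth _ _ 1) (_ - _)%N => n m.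
have D0 : 0 < a1 - a2 by rewrite subr_gt0 (lt_trans a2_lt0).
(* The sign goes into the power of a2, and the opposite denominator a2 - a1 turns the sum into a
   difference. *)
have -> : (-1) ^+ n *
   (a1 ^+ (m + n) * a2 ^+ n * ((a1 - t * a2) / (a1 - a2)) +
    a2 ^+ (m + n) * a1 ^+ n * ((a2 - t * a1) / (a2 - a1))) =
  (a1 * - a2) ^+ n *
   ((a1 ^+ m * (a1 - t * a2) - a2 ^+ m * (a2 - t * a1)) / (a1 - a2)).
  by rewrite -[a2 - a1]opprB invrN exprMn [(- a2) ^+ n]exprNn !exprD; ring.
apply: mulr_ge0; first by rewrite exprn_ge0 // mulr_ge0 ?oppr_ge0 // ltW.
by rewrite divr_ge0 ?(ltW D0) // subr_ge0 weighted_power_le.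
Qed.

(* At (a1, a2, 0, X, 2X, ...) every term of the formula contains the vanishing
   variable, while the denominators do not vanish; at X = 0 this point becomes
   (a1, a2, 0, ..., 0). *)
Lemma Phi_is_P_many_parts (lam : seq nat) P :
  0%N \notin lam -> is_P t lam P -> (2 < size lam)%N -> Phi a1 a2 P = 0.
Proof.
move=> lam0 hP; case DN: (size lam) => [|[|[|n]]] // _.
pose N := n.+3.
pose y (i : 'I_N) : {poly R} :=
  match nat_of_ord i with 0%N => a1%:P | 1%N => a2%:P | k.+2 => 'X *+ k end.
pose h0 : {rmorphism mpoly N R -> {poly R}} := mpoly.mmap (@polyC R) y.
(* Evaluating the formula requires a field, whereas setting X = 0 requires polynomials: hence both
   [h] and [h0]. *)
pose h : {rmorphism mpoly N R -> {fraction {poly R}}} := @tofrac _ \o h0.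
have h0X i : h0 'X_i = y i by rewrite /h0 /= mmapX mmap1U.
have h0C c : h0 c%:MP = c%:P by rewrite /h0 /= mmapC.
have y0 i : (y i).[0] =
    match nat_of_ord i with 0%N => a1 | 1%N => a2 | _ => 0 end.
  by case: i => -[|[|k]] ? /=; rewrite ?hornerC // hornerMn hornerX mul0rn.
(* X = 0 separates a1, a2 and the remaining coordinates; X = 1 separates the latter, since
   coordinate i >= 2 becomes i - 2. *)
have y_inj : injective y.
  have y1 (i : 'I_N) : (2 <= i)%N -> (y i).[1] = (i - 2)%:R.
    by case: i => -[|[|k]] ? //= _; rewrite hornerMn hornerX subn2.
  have a12 := lt_eqF (lt_trans a2_lt0 a1_gt0).
  have a10 := gt_eqF a1_gt0; have a20 := lt_eqF a2_lt0.
  move=> i j yij; have := y0 i; rewrite yij y0 => /eqP.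
  have : (1 < i)%N -> (1 < j)%N -> i = j.
    move=> i1 j1; apply: val_inj => /=; apply/eqP.
    by have := y1 i i1; rewrite yij y1 // => /eqP; rewrite eqr_nat; lia.
  case: i j {yij} => [[|[|i]] ?] [[|[|j]] ?] //= H;
    rewrite ?[_ == a1]eq_sym ?[0 == a2]eq_sym ?[a1 == a2]eq_sym
      ?a12 ?a10 ?a20 //.
  - by move=> _; exact: val_inj.
  - by move=> _; exact: val_inj.
  - by move=> _; exact: H.
have hX i : h 'X_i = tofrac (y i) by rewrite -h0X.
have hC c : h c%:MP = tofrac c%:P by rewrite -h0C.
have hP0 : h (sym_vars N P) = 0.
  rewrite (hall_littlewood_specialization hP) ?DN //; first last.
  - rewrite hC tofrac_eq0 polyC_eq0.
    by rewrite gt_eqF ?v_coef_gt0.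
  - by move=> i j; rewrite !hX => /eqP; rewrite tofrac_eq => /eqP/y_inj.
  (* The coordinate of index 2 is 0. In the term of [w] it has the exponent lambda_i, which is
     positive since i < N = l(lambda). *)
  rewrite big1 ?mulr0 // => w _; pose i := (w^-1)%g (inord 2).
  rewrite (bigD1 i) // hX permKV /y /= inordK // mulr0n rmorph0.
  by rewrite expr0n eqn0Ngt lt0n (memPn lam0) ?mem_nth ?DN // !mul0r.
(* The extra zeros do not change the power sums, whose exponents k + 1 are positive. *)
have <- : (h0 (sym_vars N P)).[0] = Phi a1 a2 P.
  rewrite -horner_evalE /sym_vars (rmorph_sym_eval h0) rmorph_sym_eval.
  apply: eq_sym_eval => [c|k] /=; first by rewrite h0C horner_evalE hornerC.
  rewrite !big_ord_recl !big_ord0 big1 => [|i _];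
    rewrite !h0X !horner_evalE !y0.
    by rewrite expr0n !addr0.
  by rewrite !lift0 expr0n.
by move/eqP: hP0; rewrite /h /= tofrac_eq0 => /eqP ->; rewrite horner0.
Qed.

(** Passing from P to Q multiplies by a positive constant, so the sign is decided by the two cases
    above, according to the number of parts. *)
Lemma Phi_is_Qtilde_ge0 lam F :
  is_partition lam -> is_Qtilde t lam F -> 0 <= Phi a1 a2 F.
Proof.
move=> lamP [_ [P hP ->] ->]; rewrite !PhiZ mulrCA.
rewrite mulr_ge0 ?(ltW (b_coef_gt0 _ _)) //.
have [size2|size3] := leqP (size lam) 2; first exact: Phi_is_P_two_parts_ge0.
by case/andP: lamP => _ lam0; rewrite (Phi_is_P_many_parts lam0 hP) ?mulr0.
Qed.

End TwoVariables.

Theorem proposition8p15 (R : realType) (t a1 a2 : R)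
    (ht : -1 < t < 0)
    (ha : a2 < 0 < a1)
    (hnorm : a1 ^+ 2 + a2 ^+ 2 = 1)
    (habs : `|a2| < a1)
    (star : bool) :
  (forall F : symfun R, sym_part star F ->
     Phi a1 a2 (power_sum R 2 * F) = Phi a1 a2 F) /\
  (forall F : symfun R, C_HL star t F -> 0 <= Phi a1 a2 F).
Proof.
split=> F; first by rewrite Phi_power_sumM // hnorm mul1r.
case=> n [c [G [cG ->]]]; rewrite Phi_sum; apply: sumr_ge0 => i _.
have [c_ge0 [lam [lamP _ hG]]] := cG i; rewrite PhiZ mulr_ge0 //.
have [[tN1 t0] [a2_lt0 a1_gt0]] := (andP ht, andP ha).
by apply: (Phi_is_Qtilde_ge0 tN1 t0 _ _ _ lamP hG); rewrite // -ltr0_norm.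
Qed.
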